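(* Let $Q$ be a quiver with nodes $1,\dots,n$, let $G\subset S_n$ be a group acting on $Q$ by quiver isomorphisms, with orbits $O_1,\dots,O_m$ on the nodes and chosen representatives $x_k\in O_k$. Suppose that the orbit $O_j$ is cycle-free, i.e. the entry in position $(j,j)$ of the folded exchange matrix $B^Q_G(x_1,\dots,x_m)$ is zero. Let $Q'$ be the quiver obtained from $Q$ by set mutation at the orbit $O_j$. Then $$\mu_j\big(B^Q_G(x_1,\dots,x_m)\big)=B^{Q'}_G(x_1,\dots,x_m).$$
   Context: A quiver is a finite directed graph (multiple arrows allowed) without loops and without oriented 2-cycles. Its exchange matrix $B^Q=(b_{uv})$ is the skew-symmetric integer matrix with $b_{uv}=l$ if there are $l$ arrows from $u$ to $v$, $b_{uv}=-l$ if there are $l$ arrows from $v$ to $u$, and $0$ otherwise. $G$ acts by quiver isomorphisms if $b_{g\cdot u,\,g\cdot v}=b_{uv}$ for all $g\in G$ and all nodes $u,v$. Quiver mutation at a node $k$: for every pair of arrows $i\to k$, $k\to j$ add an arrow $i\to j$; remove oriented 2-cycles; reverse all arrows incident to $k$. An orbit $O_j$ is cycle-free if there are no arrows of $Q$ between nodes of $O_j$. Set mutation at a cycle-free orbit means mutating at each node of the orbit exactly once (the order does not matter). Let $R=\mathbb{Z}[G][|G|^{-1}]$ (the group ring of $G$ over $\mathbb{Z}[1/|G|]$). Folded exchange matrix: with $H_k=\mathrm{Stab}_G(x_k)$ and $B^Q_{x_ix_j}(g)=b_{x_i,\,g\cdot x_j}$ the signed number of arrows from $x_i$ to $g\cdot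 x_j$, $B^Q_G(x_1,\dots,x_m)=(c_{ij})\in M_m(R)$ has entries $$c_{ij}=\frac{1}{|H_j|}\sum_{g\in G}B^Q_{x_ix_j}(g)\,g .$$ $B^{Q'}_G(x_1,\dots,x_m)$ is defined in the same way from $Q'$, with the same action of $G$ on nodes. Positive and negative parts: for a number $a$, $[a]_+=\max(a,0)$ and $[a]_-=\min(a,0)$; for $a=\sum_g a_g g\in R$, $[a]_\pm=\sum_g[a_g]_\pm\, g$. Matrix mutation at index $j$ of $B=(b_{ik})\in M_m(R)$ is $\mu_j(B)=(b'_{ik})$ with $b'_{ik}=-b_{ik}$ if $i=j$ or $k=j$, and $b'_{ik}=b_{ik}+[b_{ij}]_+[b_{jk}]_+-[b_{ij}]_-[b_{jk}]_-$ otherwise. *)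

(* Defs.v *)
From HB Require Import structures.
From mathcomp Require Import all_boot all_order all_fingroup all_algebra.

Set Implicit Arguments.
Unset Strict Implicit.
Unset Printing Implicit Defensive.

Import Order.TTheory GRing.Theory Num.Theory.
Local Open Scope ring_scope.

(* In lowest terms, the denominator has only prime factors dividing N; see
   [in_ZinvP] for the description by powers of N. *)
Definition in_Zinv (N : nat) : {pred rat} :=
  fun x => \pi(N).-nat `|denq x|%N.

Lemma in_Zinv_den N (d : nat) (x : rat) :
  \pi(N).-nat d -> x * d%:R \is a Num.int -> x \in in_Zinv N.
Proof.
move=> dN /intrP[z xdz]; have d_gt0 : (0 < d)%N by case/andP: dN.
rewrite unfold_in; apply: pnat_dvd dN.
have dn0 : d%:R != 0 :> rat by rewrite pnatr_eq0 -lt0n.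
have : (numq x * d%:Z)%:~R = (z * denq x)%:~R :> rat.
  by rewrite !intrM numqE -xdz mulrAC.
move/intr_inj => e.
have : (`|denq x| %| `|numq x| * d)%N.
  have -> : (`|numq x| * d)%N = `|(numq x * d%:Z)%R|%N by rewrite abszM absz_nat.
  by rewrite e abszM dvdn_mull.
by rewrite Gauss_dvdr // coprime_sym coprime_num_den.
Qed.

Lemma in_ZinvP (N : nat) (x : rat) : (0 < N)%N ->
  reflect (exists k : nat, x * N%:R ^+ k \is a Num.int) (x \in in_Zinv N).
Proof.
move=> N0; apply: (iffP idP) => [xN|[k xk]]; last first.
  apply: (@in_Zinv_den _ (N ^ k)); last by rewrite natrX.
  by rewrite pnatX pnat_pi.
set d := `|denq x|%N.
have d0 : (0 < d)%N by rewrite absz_gt0 denq_neq0.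
have dvdN : (d %| N ^ d)%N.
  apply/dvdn_partP => // p pd.
  have p_pr : prime p by move: pd; rewrite mem_primes => /andP[].
  have pN : p \in \pi(N) by exact: (pnatPpi xN pd).
  rewrite p_part; apply: (@dvdn_trans (p ^ d)); last first.
    by apply: dvdn_exp2r; move: pN; rewrite mem_primes => /and3P[].
  apply: dvdn_exp2l; apply: ltnW; apply: (@leq_trans (p ^ logn p d)).
    exact: ltn_expl (prime_gt1 p_pr).
  by rewrite dvdn_leq // -p_part dvdn_part.
have [c Nc] := dvdnP dvdN; exists d.
rewrite -natrX Nc natrM [c%:R * _]mulrC mulrA.
suff -> : x * d%:R = (numq x)%:~R by rewrite rpredM ?intr_int ?intr_nat ?rpred_nat.
by rewrite numqE -[denq x in RHS]absz_denq.
Qed.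

Lemma in_Zinv_mulden N x : x \in in_Zinv N ->
  exists2 d : nat, \pi(N).-nat d & x * d%:R \is a Num.int.
Proof.
move=> xN; exists `|denq x|%N => //.
have -> : `|denq x|%N%:R = (denq x)%:~R :> rat by rewrite -[in RHS]absz_denq.
by rewrite -numqE intr_int.
Qed.

Fact in_Zinv_subring N : subring_closed (in_Zinv N).
Proof.
split=> [|x y|x y].
- by apply: (@in_Zinv_den _ 1) => //; rewrite mulr1 rpred1.
- move=> /in_Zinv_mulden[d dN dx] /in_Zinv_mulden[e eN ey].
  apply: (@in_Zinv_den _ (d * e)); first by rewrite pnatM dN.
  rewrite natrM mulrBl mulrA [y * _]mulrCA -[y * _]mulrC.
  by rewrite rpredB // rpredM // ?rpred_nat // mulrC.
- move=> /in_Zinv_mulden[d dN dx] /in_Zinv_mulden[e eN ey].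
  apply: (@in_Zinv_den _ (d * e)); first by rewrite pnatM dN.
  by rewrite natrM mulrACA rpredM.
Qed.
HB.instance Definition _ N :=
  GRing.isSubringClosed.Build rat (in_Zinv N) (in_Zinv_subring N).

Record Zinv (N : nat) := MkZinv { Zinv_val : rat; _ : Zinv_val \in in_Zinv N }.

HB.instance Definition _ N := [isSub for @Zinv_val N].
HB.instance Definition _ N := [Choice of Zinv N by <:].
HB.instance Definition _ N := [SubChoice_isSubComNzRing of Zinv N by <:].

Section ZinvStructure.
Variable N : nat.
Implicit Types x y : Zinv N.

Definition Zinv_unit : {pred Zinv N} :=
  fun x => (val x != 0) && ((val x)^-1 \in in_Zinv N).
Definition Zinv_inv x : Zinv N := insubd x (val x)^-1.

Fact Zinv_mulVx : {in Zinv_unit, left_inverse 1 Zinv_inv *%R}.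
Proof.
move=> x /andP[x0 xV]; apply: val_inj.
by rewrite rmorphM rmorph1 /= val_insubd xV mulVf.
Qed.
Fact Zinv_unitPl x y : y * x = 1 -> Zinv_unit x.
Proof.
move/(congr1 val); rewrite rmorphM rmorph1 /= => yx1.
have x0 : Zinv_val x != 0.
  by apply: contraPneq yx1 => ->; rewrite mulr0 => /eqP; rewrite eq_sym oner_eq0.
by rewrite /Zinv_unit /= x0 -(mulr1_eq yx1) invrK (valP y).
Qed.
Fact Zinv_invr_out : {in [predC Zinv_unit], Zinv_inv =1 id}.
Proof.
move=> x; rewrite inE /= => xU; apply: val_inj; rewrite val_insubd.
case: ifP => // xV; move: xU; rewrite unfold_in xV andbT negbK.
by move/eqP=> ->; rewrite invr0.
Qed.
HB.instance Definition _ := GRing.ComNzRing_hasMulInverse.Build (Zinv N)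
  Zinv_mulVx Zinv_unitPl Zinv_invr_out.
HB.instance Definition _ :=
  [SubComUnitRing_isSubIntegralDomain of Zinv N by <:].

Definition Zinv_le x y := val x <= val y.
Definition Zinv_lt x y := val x < val y.
Definition Zinv_norm x := if Zinv_le 0 x then x else - x.

Fact Zinv_le0D x y : Zinv_le 0 x -> Zinv_le 0 y -> Zinv_le 0 (x + y).
Proof. exact: addr_ge0. Qed.
Fact Zinv_le0M x y : Zinv_le 0 x -> Zinv_le 0 y -> Zinv_le 0 (x * y).
Proof. exact: mulr_ge0. Qed.
Fact Zinv_le0_anti x : Zinv_le 0 x -> Zinv_le x 0 -> x = 0.
Proof. by move=> x0 x0'; apply/val_inj/le_anti/andP. Qed.
Fact Zinv_sub_ge0 x y : Zinv_le 0 (y - x) = Zinv_le x y.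
Proof. by rewrite /Zinv_le rmorphB rmorph0 subr_ge0. Qed.
Fact Zinv_le0_total x : Zinv_le 0 x || Zinv_le x 0.
Proof. exact: le_total. Qed.
Fact Zinv_normN x : Zinv_norm (- x) = Zinv_norm x.
Proof.
rewrite /Zinv_norm /Zinv_le rmorphN rmorph0 oppr_ge0 opprK.
by case: (ltgtP (val x) 0) => // x0; have -> : x = 0 by [exact: val_inj]; rewrite oppr0.
Qed.
Fact Zinv_ge0_norm x : Zinv_le 0 x -> Zinv_norm x = x.
Proof. by rewrite /Zinv_norm => ->. Qed.
Fact Zinv_lt_def x y : Zinv_lt x y = (y != x) && Zinv_le x y.
Proof. by rewrite /Zinv_lt lt_def. Qed.
HB.instance Definition _ := Num.IntegralDomain_isLeReal.Build (Zinv N)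
  Zinv_le0D Zinv_le0M Zinv_le0_anti Zinv_sub_ge0 Zinv_le0_total
  Zinv_normN Zinv_ge0_norm Zinv_lt_def.

Lemma Zinv_unit_dvd (d : nat) :
  (0 < N)%N -> (d %| N)%N -> (d%:R : Zinv N) \is a GRing.unit.
Proof.
move=> N0 dN; have d0 := dvdn_gt0 N0 dN.
have dn0 : d%:R != 0 :> rat by rewrite pnatr_eq0 -lt0n.
rewrite unfold_in /= /Zinv_unit rmorph_nat dn0 /=.
apply: (@in_Zinv_den _ d); last by rewrite mulVf // rpred1.
by apply: pnat_dvd (pnat_pi N0).
Qed.

End ZinvStructure.

(* Formal sums of elements of G, encoded by their coefficient functions. *)
Definition gring (A : comNzRingType) n (G : {group 'S_n}) : Type :=
  {ffun [subg G] -> A}.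

Section GroupRing.
Variables (A : comNzRingType) (n : nat) (G : {group 'S_n}).
Implicit Types (g h k : [subg G]) (a b c : gring A G).

HB.instance Definition _ := GRing.Zmodule.copy (gring A G) {ffun [subg G] -> A}.

(* Permutations act on the left here, (g h) . x = g . (h . x), whereas the
   product of ['S_n] is the composition in diagrammatic order. *)
Definition gcomp g h : [subg G] := (h * g)%g.

Lemma gcompE g h (x : 'I_n) : val (gcomp g h) x = val g (val h x).
Proof. by rewrite /gcomp /= permM. Qed.

Definition gring_scale (r : A) a : gring A G := [ffun g => r * a g].
Definition gring_delta g : gring A G := [ffun h => (h == g)%:R].
Definition gring_one : gring A G := gring_delta 1%g.
Definition gring_mul a b : gring A G :=
  [ffun k => \sum_g \sum_(h | gcomp g h == k) a g * b h].

Lemma gring_mulE a b k : gring_mul a b k = \sum_g a g * b (k * g^-1)%g.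
Proof.
rewrite ffunE; apply: eq_bigr => g _; rewrite (big_pred1 (k * g^-1)%g) // => h.
by apply/eqP/eqP => [<-|->]; rewrite /gcomp ?mulgK ?mulgKV.
Qed.

Fact gring_mulA : associative gring_mul.
Proof.
move=> a b c; apply/ffunP => k; rewrite !gring_mulE.
under eq_bigr => h _ do rewrite gring_mulE big_distrr.
under [RHS]eq_bigr => g _ do rewrite gring_mulE big_distrl.
rewrite [RHS]exchange_big; apply: eq_bigr => h _ /=.
rewrite [RHS](reindex_inj (mulIg h)); apply: eq_bigr => u _ /=.
by rewrite mulgK invMg mulgA mulrA.
Qed.
Fact gring_mul1 : left_id gring_one gring_mul.
Proof.
move=> a; apply/ffunP => k; rewrite gring_mulE (bigD1 1%g) //= big1 => [|g g1].
  by rewrite ffunE eqxx mul1r invg1 mulg1 addr0.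
by rewrite ffunE (negPf g1) mul0r.
Qed.
Fact gring_mulr1 : right_id gring_one gring_mul.
Proof.
move=> a; apply/ffunP => k; rewrite gring_mulE (bigD1 k) //= big1 => [|g gk].
  by rewrite ffunE mulgV eqxx mulr1 addr0.
by rewrite ffunE -eq_mulgV1 eq_sym (negPf gk) mulr0.
Qed.
Fact gring_mulDl : left_distributive gring_mul +%R.
Proof.
move=> a b c; apply/ffunP => k; rewrite [RHS]ffunE !gring_mulE -big_split.
by apply: eq_bigr => g _; rewrite ffunE mulrDl.
Qed.
Fact gring_mulDr : right_distributive gring_mul +%R.
Proof.
move=> a b c; apply/ffunP => k; rewrite [RHS]ffunE !gring_mulE -big_split.
by apply: eq_bigr => g _; rewrite ffunE mulrDr.
Qed.
Fact gring_one_neq0 : gring_one != 0.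
Proof.
by apply/eqP => /ffunP/(_ 1%g)/eqP; rewrite !ffunE eqxx oner_eq0.
Qed.
HB.instance Definition _ := GRing.Zmodule_isNzRing.Build (gring A G)
  gring_mulA gring_mul1 gring_mulr1 gring_mulDl gring_mulDr gring_one_neq0.

Fact gring_scaleA r s a :
  gring_scale r (gring_scale s a) = gring_scale (r * s) a.
Proof. by apply/ffunP => g; rewrite !ffunE mulrA. Qed.
Fact gring_scale1 : left_id 1 gring_scale.
Proof. by move=> a; apply/ffunP => g; rewrite !ffunE mul1r. Qed.
Fact gring_scaleDr : right_distributive gring_scale +%R.
Proof. by move=> r a b; apply/ffunP => g; rewrite !ffunE mulrDr. Qed.
Fact gring_scaleDl a : {morph gring_scale^~ a : r s / r + s}.
Proof. by move=> r s; apply/ffunP => g; rewrite !ffunE mulrDl. Qed.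
HB.instance Definition _ := GRing.Zmodule_isLmodule.Build A (gring A G)
  gring_scaleA gring_scale1 gring_scaleDr gring_scaleDl.

Lemma gring_deltaM g h :
  gring_delta g * gring_delta h = gring_delta (gcomp g h) :> gring A G.
Proof.
apply/ffunP => k; rewrite -[LHS]/(gring_mul _ _ k) gring_mulE.
rewrite (bigD1 g) //= big1 => [|u ug].
  rewrite !ffunE eqxx mul1r addr0; congr (nat_of_bool _)%:R.
  by apply/eqP/eqP => [<-|->]; rewrite /gcomp ?mulgK ?mulgKV.
by rewrite ffunE (negPf ug) mul0r.
Qed.

End GroupRing.

Definition gring_pos (A : realDomainType) n (G : {group 'S_n})
  (a : gring A G) : gring A G := [ffun g => Num.max (a g) 0].
Definition gring_neg (A : realDomainType) n (G : {group 'S_n})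
  (a : gring A G) : gring A G := [ffun g => Num.min (a g) 0].

Definition mx_mutation (A : realDomainType) n (G : {group 'S_n}) m (j : 'I_m)
    (B : 'M[gring A G]_m) : 'M[gring A G]_m :=
  \matrix_(i, k)
    if (i == j) || (k == j) then - B i k
    else B i k + gring_pos (B i j) * gring_pos (B j k)
               - gring_neg (B i j) * gring_neg (B j k).

(* [arrows u v] is the number of arrows from u to v. *)
Record quiver (n : nat) := Quiver {
  arrows :> 'I_n -> 'I_n -> nat;
  no_loops : forall u, arrows u u = 0%N;
  no_2cycles : forall u v, arrows u v = 0%N \/ arrows v u = 0%N
}.

Definition exchange_mx n (Q : quiver n) : 'M[int]_n :=
  \matrix_(u, v) ((Q u v)%:Z - (Q v u)%:Z).

Lemma exchange_mxE n (Q : quiver n) u v :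
  exchange_mx Q u v = if Q v u == 0%N then (Q u v)%:Z else - (Q v u)%:Z.
Proof.
rewrite mxE; case: eqP => [->|vu]; first by rewrite subr0.
by have [->|//] := no_2cycles Q u v; rewrite sub0r.
Qed.

Lemma exchange_mx_eq0 n (Q : quiver n) u v :
  (exchange_mx Q u v == 0) = (Q u v == 0%N) && (Q v u == 0%N).
Proof.
rewrite exchange_mxE; have [vu|vu] := eqVneq (Q v u) 0%N; first by rewrite andbT.
by rewrite andbF oppr_eq0; apply/negbTE.
Qed.

Section Mutation.
Variables (n : nat) (Q : quiver n) (k : 'I_n).

Definition mut_add (i j : 'I_n) : nat := (Q i j + Q i k * Q k j)%N.
(* Cancelling a maximal set of 2-cycles between i and j; [subn] truncates. *)
Definition mut_cancel (i j : 'I_n) : nat := (mut_add i j - mut_add j i)%N.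
Definition mut_arrows (i j : 'I_n) : nat :=
  if (i == k) || (j == k) then mut_cancel j i else mut_cancel i j.

Fact mut_no_loops u : mut_arrows u u = 0%N.
Proof. by rewrite /mut_arrows /mut_cancel subnn if_same. Qed.
Fact mut_no_2cycles u v : mut_arrows u v = 0%N \/ mut_arrows v u = 0%N.
Proof.
rewrite /mut_arrows [(v == k) || _]orbC /mut_cancel.
by have [h|/ltnW h] := leqP (mut_add u v) (mut_add v u);
  case: ifP => _; [right|left|left|right]; apply/eqP; rewrite subn_eq0.
Qed.
Definition mutation : quiver n := Quiver mut_no_loops mut_no_2cycles.
End Mutation.

Definition quiver_action n (G : {group 'S_n}) (Q : quiver n) : Prop :=
  forall g : 'S_n, g \in G -> forall u v : 'I_n,
    exchange_mx Q (g u) (g v) = exchange_mx Q u v.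

Definition cycle_free n (Q : quiver n) (O : {set 'I_n}) : Prop :=
  forall u v : 'I_n, u \in O -> v \in O -> Q u v = 0%N.

(* Q' is obtained by mutating at each node of O exactly once, in some order. *)
Definition set_mutation n (Q : quiver n) (O : {set 'I_n}) (Q' : quiver n) :
    Prop :=
  exists2 s : seq 'I_n, perm_eq s (enum O) & Q' = foldl (@mutation n) Q s.

(* Z[G][1/|G|] *)
Definition folding_ring n (G : {group 'S_n}) := gring (Zinv #|G|) G.

Definition folded_mx n (G : {group 'S_n}) (Q : quiver n) m (x : 'I_m -> 'I_n) :
    'M[folding_ring G]_m :=
  \matrix_(i, j) (#|'C_G[x j | 'P]%g|%:R^-1 *:
    \sum_(g : [subg G])
      (exchange_mx Q (x i) (val g (x j)))%:~R *: gring_delta _ g).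

(* ['P] is a right action of G, with the same orbits and point stabilisers as
   the left action (g, u) |-> g u. *)
Definition orbit_reps n (G : {group 'S_n}) m
    (O : 'I_m -> {set 'I_n}) (x : 'I_m -> 'I_n) : Prop :=
  [/\ injective O,
      O @: [set: 'I_m] = orbit 'P%act G @: [set: 'I_n]
    & forall k, x k \in O k].

Lemma folded_mxE n (G : {group 'S_n}) (Q : quiver n) m (x : 'I_m -> 'I_n) i j
    (g : [subg G]) :
  folded_mx G Q x i j g =
  #|'C_G[x j | 'P]%g|%:R^-1 * (exchange_mx Q (x i) (val g (x j)))%:~R.
Proof.
rewrite mxE [LHS]ffunE sum_ffunE (bigD1 g) //= big1 => [|h hg]; last first.
  by rewrite [LHS]ffunE ffunE eq_sym (negPf hg) mulr0.
by rewrite addr0 [X in _ * X]ffunE ffunE eqxx mulr1.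
Qed.

Lemma cycle_freeP n (G : {group 'S_n}) (Q : quiver n) m
    (O : 'I_m -> {set 'I_n}) (x : 'I_m -> 'I_n) (j : 'I_m) :
  quiver_action G Q -> orbit_reps G O x ->
  cycle_free Q (O j) <-> folded_mx G Q x j j = 0.
Proof.
move=> GQ [_ OE xO].
have Oj : O j = orbit 'P%act G (x j).
  have : O j \in orbit 'P%act G @: [set: 'I_n] by rewrite -OE imset_f.
  case/imsetP => u _ Ou; rewrite Ou; apply/orbit_eqP.
  by have := xO j; rewrite Ou orbit_sym.
have Hj : (#|'C_G[x j | 'P]%g|%:R : Zinv #|G|)^-1 != 0.
  rewrite invr_eq0; have := @Zinv_unit_dvd #|G| #|'C_G[x j | 'P]%g|.
  move=> /(_ (cardG_gt0 G))/(_ (cardSg (subsetIl _ _))).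
  by case: eqP => // ->; rewrite unitr0.
split=> [cf|c0 u v].
  apply/ffunP => g; rewrite folded_mxE !ffunE.
  have gx : val g (x j) \in O j by rewrite Oj; apply: mem_orbit (valP g).
  by rewrite mxE !cf // subr0 mulr0.
rewrite Oj => /orbitP[g gG <-] /orbitP[h hG <-]; rewrite /= !apermE.
have kG : (h * g^-1)%g \in G by rewrite groupM ?groupV.
move/ffunP/(_ (subg G (h * g^-1)%g)): c0; rewrite folded_mxE [X in _ = X]ffunE.
move/eqP; rewrite mulf_eq0 (negPf Hj) /= intr_eq0 subgK //.
rewrite -(GQ g) // permM permKV exchange_mx_eq0.
by case/andP => /eqP.
Qed.

(* Main.v *)
(* In a cycle-free orbit O the mutations at the individual nodes do not
   interact, so for u, v outside O set mutation adds to b_uv the sum over w in O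
   of [b_uw]_+ [b_wv]_+ - [b_uw]_- [b_wv]_-.  The coefficient at g of the product
   c_ij c_jk (with the signs [.]_+ or [.]_-) is a sum over a in G of terms with
   entries b_{x_i, a x_j} and b_{x_j, a^-1 g x_k} = b_{a x_j, g x_k}; each
   w = a x_j in O occurs |H_j| times, which cancels the factor 1/|H_j|. *)

Require Import Defs.
From HB Require Import structures.
From mathcomp Require Import all_boot all_order all_fingroup all_algebra.
From mathcomp Require Import zify.
Import Order.TTheory GRing.Theory Num.Theory.
Local Open Scope ring_scope.

(** For [B = exchange_mx Q], this is the number of paths u -> k -> v minus the number of paths v ->
    k -> u. *)
Definition signed_paths {n} (B : 'M[int]_n) (k u v : 'I_n) : int :=
  Num.max (B u k) 0 * Num.max (B k v) 0 - Num.min (B u k) 0 * Num.min (B k v) 0.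

(** At most one of [Q u v] and [Q v u] is nonzero, so their difference involves no cancellation. *)
Lemma exchange_mx_max n (Q : quiver n) u v :
  Num.max (exchange_mx Q u v) 0 = (Q u v)%:Z.
Proof. by rewrite mxE; have [] := no_2cycles Q u v; lia. Qed.

Lemma exchange_mx_min n (Q : quiver n) u v :
  Num.min (exchange_mx Q u v) 0 = - (Q v u)%:Z.
Proof. by rewrite mxE; have [] := no_2cycles Q u v; lia. Qed.

Lemma exchange_mx_mutation n (Q : quiver n) k u v :
  exchange_mx (mutation Q k) u v =
  if (u == k) || (v == k) then - exchange_mx Q u v
  else exchange_mx Q u v + signed_paths (exchange_mx Q) k u v.
Proof.
rewrite /signed_paths !exchange_mx_max !exchange_mx_min !mxE /=.
rewrite /mut_arrows [(v == k) || _]orbC /mut_cancel /mut_add.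
(* Cancelling 2-cycles preserves the difference of the two arrow counts; at [k] itself [no_loops]
   removes the added paths. *)
case: ifP => [/orP[]/eqP->|_]; rewrite ?no_loops ?mul0n ?muln0; nia.
Qed.

Lemma signed_paths_eq0 n (B : 'M[int]_n) k u v :
  B u k = 0 \/ B k v = 0 -> signed_paths B k u v = 0.
Proof.
by rewrite /signed_paths => -[]->; rewrite maxxx minxx ?mul0r ?mulr0 subrr.
Qed.

(* Inside a cycle-free set the mutations do not interact: mutating at k leaves
   the entries in row or column w of another node w of the set unchanged. *)
Lemma exchange_mx_foldl_mutation n (Q : quiver n) (s : seq 'I_n) u v :
    uniq s -> {in s &, forall k w, exchange_mx Q k w = 0} ->
  exchange_mx (foldl (@mutation n) Q s) u v =
  if (u \in s) || (v \in s) then - exchange_mx Q u v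
  else exchange_mx Q u v + \sum_(k <- s) signed_paths (exchange_mx Q) k u v.
Proof.
elim: s Q => [|k s IHs] Q /=; first by rewrite big_nil addr0.
case/andP=> ks s_uniq Q0.
have kk : k \in k :: s by rewrite mem_head.
have ss w : w \in s -> w \in k :: s by rewrite in_cons orbC => ->.
have neqk w : w \in s -> (w == k) = false by apply: contraTF => /eqP->.
have mutl a w : w \in s -> a != k ->
    exchange_mx (mutation Q k) a w = exchange_mx Q a w.
  move=> ws /negPf ak; rewrite exchange_mx_mutation ak neqk //=.
  by rewrite signed_paths_eq0 ?addr0 //; right; apply: Q0 kk (ss _ ws).
have mutr a w : w \in s -> a != k ->
    exchange_mx (mutation Q k) w a = exchange_mx Q w a.
  move=> ws /negPf ak; rewrite exchange_mx_mutation ak neqk //=.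
  by rewrite signed_paths_eq0 ?addr0 //; left; apply: Q0 (ss _ ws) kk.
have mutk w : w \in s -> exchange_mx (mutation Q k) k w = 0.
  by move=> ws; rewrite exchange_mx_mutation eqxx /= (Q0 _ _ kk (ss _ ws)) oppr0.
have mutk' w : w \in s -> exchange_mx (mutation Q k) w k = 0.
  by move=> ws; rewrite exchange_mx_mutation eqxx orbT /= (Q0 _ _ (ss _ ws) kk) oppr0.
(* The induction hypothesis is applied to [mutation Q k], whose entries between nodes of [s] still
   vanish. *)
rewrite IHs // => [|a b sa sb]; last first.
  by rewrite mutl ?neqk // (Q0 _ _ (ss _ sa) (ss _ sb)).
rewrite !in_cons big_cons.
case: ifPn => [/orP[us|vs]|].
- rewrite us orbT /=; have [->|vk] := eqVneq v k; first by rewrite mutk' // (Q0 _ _ (ss _ us) kk).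
  by rewrite mutr.
- rewrite vs !orbT /=; have [->|uk] := eqVneq u k; first by rewrite mutk // (Q0 _ _ kk (ss _ vs)).
  by rewrite mutl.
rewrite negb_or => /andP[/negPf us /negPf vs]; rewrite us vs !orbF.
case: ifPn => [uvk|].
  (* With [u] or [v] equal to [k], the first mutation does the negation; entries between [k] and [s]
     vanish, so the later ones add nothing. *)
  rewrite exchange_mx_mutation uvk big1_seq ?addr0 // => w /= ws.
  by apply: signed_paths_eq0; case/orP: uvk => /eqP->; [left|right]; auto.
move=> uvk; rewrite exchange_mx_mutation (negPf uvk) -[LHS]addrA.
have /norP[uk vk] := uvk.
congr (_ + (_ + _)); apply: eq_big_seq => w ws.
by rewrite /signed_paths mutl ?mutr.
Qed.

(** Orbit-stabiliser count: the elements sending [x] to a given node of its orbit form a coset of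
    the stabiliser. *)
Lemma sum_orbit n (G : {group 'S_n}) (V : zmodType) (F : 'I_n -> V) x :
  \sum_(g : [subg G]) F (val g x) =
  (\sum_(y in orbit 'P%act G x) F y) *+ #|'C_G[x | 'P]%g|.
Proof.
have -> : \sum_(g : [subg G]) F (val g x) = \sum_(g in G) F (g x).
  rewrite [RHS](reindex (@sgval _ G)) /=; last first.
    by exists (subg G) => g gG; rewrite ?sgvalK ?subgK.
  by apply: eq_bigl => g; rewrite subgP.
rewrite (partition_big (fun g : 'S_n => g x) (mem (orbit 'P%act G x))) /=.
  rewrite -sumrMnl; apply: eq_bigr => _ /orbitP[a aG <-].
  rewrite (eq_bigr (fun=> F ('P%act x a))) => [|g /andP[_ /eqP->]] //.
  have := amove_act 'P x (subsetT G) aG => /(congr1 (fun A : {set _} => #|A|)).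
  rewrite card_rcoset => <-; rewrite -sumr_const.
  by apply: eq_bigl => g; rewrite inE.
by move=> g gG; apply: mem_orbit gG.
Qed.

Lemma intr_maxr0 (A : realDomainType) (b : int) :
  (Num.max b 0)%:~R = Num.max b%:~R 0 :> A.
Proof.
case: (leP b 0) => [b0|/ltW b0]; first by rewrite max_r ?lerz0.
by rewrite max_l ?ler0z.
Qed.

(** The identity [max b 0 + min b 0 = b] reduces this to [intr_maxr0]. *)
Lemma intr_minr0 (A : realDomainType) (b : int) :
  (Num.min b 0)%:~R = Num.min b%:~R 0 :> A.
Proof.
apply: (@addrI _ (Num.max b%:~R 0)); rewrite addr_max_min -intr_maxr0.
by rewrite -intrD addr_max_min !addr0.
Qed.

Lemma orbit_repsE {n} {G : {group 'S_n}} {m} {O : 'I_m -> {set 'I_n}} {x} j :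
  orbit_reps G O x -> O j = orbit 'P%act G (x j).
Proof.
case=> _ OE xO; have : O j \in orbit 'P%act G @: [set: 'I_n].
  by rewrite -OE imset_f.
case/imsetP => u _ Ou; rewrite Ou; apply/orbit_eqP.
by have := xO j; rewrite Ou orbit_sym.
Qed.

Lemma mem_orbit_reps {n} {G : {group 'S_n}} {m} {O : 'I_m -> {set 'I_n}} {x} i j
    (g : 'S_n) :
  orbit_reps G O x -> g \in G -> (g (x i) \in O j) = (i == j).
Proof.
move=> Ox gG; have [Oinj _ _] := Ox; rewrite -(inj_eq Oinj).
rewrite !(orbit_repsE _ Ox).
apply/idP/eqP => [gO|<-]; last exact: (mem_orbit 'P _ gG).
by apply/orbit_eqP; rewrite -(orbit_actr 'P _ _ gG).
Qed.

(** Nonnegative scalars commute with taking positive and negative parts, so [r] and [s] factor out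
    and only integer coefficients are convolved. *)
Lemma gring_pos_neg_mul {A : realDomainType} {n} {G : {group 'S_n}}
    {a b : gring A G} {r s : A} {p q : [subg G] -> int} (g : [subg G]) :
    0 <= r -> 0 <= s ->
    (forall h, a h = r * (p h)%:~R) -> (forall h, b h = s * (q h)%:~R) ->
  (gring_pos a * gring_pos b - gring_neg a * gring_neg b) g =
  r * s * \sum_h (Num.max (p h) 0 * Num.max (q (g * h^-1)%g) 0
                  - Num.min (p h) 0 * Num.min (q (g * h^-1)%g) 0)%:~R.
Proof.
move=> r0 s0 ap bq.
have ap_pos h : gring_pos a h = r * (Num.max (p h) 0)%:~R.
  by rewrite ffunE ap intr_maxr0 maxr_pMr ?mulr0.
have ap_neg h : gring_neg a h = r * (Num.min (p h) 0)%:~R.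
  by rewrite ffunE ap intr_minr0 minr_pMr ?mulr0.
have bq_pos h : gring_pos b h = s * (Num.max (q h) 0)%:~R.
  by rewrite ffunE bq intr_maxr0 maxr_pMr ?mulr0.
have bq_neg h : gring_neg b h = s * (Num.min (q h) 0)%:~R.
  by rewrite ffunE bq intr_minr0 minr_pMr ?mulr0.
rewrite [LHS]ffunE [X in _ + X]ffunE [X in X - _]gring_mulE.
rewrite [X in _ - X]gring_mulE -sumrB mulr_sumr; apply: eq_bigr => h _.
rewrite ap_pos ap_neg bq_pos bq_neg mulrACA [X in _ - X]mulrACA -mulrBr.
by rewrite intrB !intrM.
Qed.

Lemma folded_mx_mul n (G : {group 'S_n}) (Q : quiver n) m (x : 'I_m -> 'I_n)
    i j k (g : [subg G]) : quiver_action G Q ->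
  (gring_pos (folded_mx G Q x i j) * gring_pos (folded_mx G Q x j k)
   - gring_neg (folded_mx G Q x i j) * gring_neg (folded_mx G Q x j k)) g =
  #|'C_G[x k | 'P]%g|%:R^-1 *
    (\sum_(w in orbit 'P%act G (x j))
       signed_paths (exchange_mx Q) w (x i) (val g (x k)))%:~R.
Proof.
move=> GQ; set H := #|'C_G[x j | 'P]%g|.
(* By Lagrange [H] divides the order of [G]; its inverse will cancel the multiplicity coming from
   [sum_orbit]. *)
have HU : (H%:R : Zinv #|G|) \is a GRing.unit.
  by apply: Zinv_unit_dvd; rewrite ?cardG_gt0 ?cardSg ?subsetIl.
(* Apply [a] to both nodes: the product [g * a^-1] acts by [g] first, so [a] undoes its last
   factor. *)
have shift a : exchange_mx Q (x j) (val (g * a^-1)%g (x k)) =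
               exchange_mx Q (val a (x j)) (val g (x k)).
  by rewrite -(GQ _ (valP a)) /= permM permKV.
have inv_ge0 l : 0 <= l%:R^-1 :> Zinv #|G| by rewrite invr_ge0 ler0n.
rewrite (gring_pos_neg_mul g (inv_ge0 _) (inv_ge0 _)
           (folded_mxE Q x i j) (folded_mxE Q x j k)).
pose F w : Zinv #|G| := (signed_paths (exchange_mx Q) w (x i) (val g (x k)))%:~R.
rewrite (eq_bigr (fun a : [subg G] => F (val a (x j)))) => [|a _]; last first.
  by rewrite /F /signed_paths -shift.
by rewrite sum_orbit -[X in _ * X = _]mulr_natl mulrAC mulKr // mulrC rmorph_sum.
Qed.

Theorem theorem3p5 (n : nat) (Q : quiver n) (G : {group 'S_n})
    (GQ : quiver_action G Q)
    (m : nat) (O : 'I_m -> {set 'I_n}) (x : 'I_m -> 'I_n)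
    (Ox : orbit_reps G O x)
    (j : 'I_m) (Oj : cycle_free Q (O j))
    (Q' : quiver n) (QQ' : set_mutation Q (O j) Q') :
  mx_mutation j (folded_mx G Q x) = folded_mx G Q' x.
Proof.
have [s sO ->] := QQ'.
have s_uniq : uniq s by rewrite (perm_uniq sO) enum_uniq.
have sE u : (u \in s) = (u \in O j) by rewrite (perm_mem sO) mem_enum.
apply/matrixP => i k; apply/ffunP => g.
rewrite [RHS]folded_mxE mxE exchange_mx_foldl_mutation //; last first.
  by move=> u v; rewrite !sE => uO vO; rewrite mxE !Oj.
have -> : x i \in s = (i == j).
  by rewrite sE -(mem_orbit_reps i j 1%g Ox) ?group1 // perm1.
rewrite sE (mem_orbit_reps _ _ _ Ox (valP g)).
case: ifP => _; first by rewrite [LHS]ffunE folded_mxE intrN mulrN.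
(* Off row and column [j], the order of the mutations disappears: [s] only lists the terms of a sum
   over [O j]. *)
rewrite -addrA [LHS]ffunE folded_mx_mul // folded_mxE intrD mulrDr.
by rewrite -(orbit_repsE _ Ox) (perm_big _ sO) big_enum.
Qed.
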